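(* Let $w,w'\in S_n$ be such that $w'$ is covered by $w$ in the Bruhat order, i.e. $w=w'\cdot(i,j)$ for some transposition $(i,j)$ with $i<j$. Then $$\kappa(w,w')=j-i.$$ In particular, $c(w,w')=0$ if and only if $j-i$ is odd.
   Context: $S_n$ is the Weyl group of $\mathrm{Sl}(n,\mathbb{R})$ (type $A_{n-1}$), with simple reflections $s_i=(i,i+1)$ attached to the simple roots $a_i=e_i-e_{i+1}$; permutations multiply by composition of functions, and $S_n$ acts on roots by $w(e_a-e_b)=e_{w(a)}-e_{w(b)}$. The positive roots are $e_a-e_b$ with $a<b$. $w$ covers $w'$ means $w'\le w$ in the Bruhat order and $\ell(w)=\ell(w')+1$; equivalently, $w=w'\cdot(i,j)$ for some $i<j$ with $w'(i)<w'(j)$ and there is no $k$ with $i<k<j$ and $w'(i)<w'(k)<w'(j)$. For $w\in S_n$ let $\Pi_w$ be the set of positive roots sent to negative roots by $w^{-1}$, and $\phi(w)=\sum_{\delta\in\Pi_w}\delta$. If $w$ covers $w'$, let $\beta$ be the unique positive root with $w=s_\beta w'$; the integer $\kappa(w,w')$ is defined by $\phi(w)-\phi(w')=\kappa(w,w')\cdot\beta$. $c(w,w')\in\mathbb{Z}$ is the coefficient of the Schubert cell $\mathcal{S}_{w'}$ in the cellular boundary $\partial\mathcal{S}_w$ for the Bruhat (Schubert) cell decomposition of the maximal real flag manifold of $\mathrm{Sl}(n,\mathbb{R})$; it is known that $c(w,w')=\pm\bigl(1+(-1)^{\kappa(w,w')}\bigr)$ whenever $w$ covers $w'$. *)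

(* Defs.v *)
From HB Require Import structures.
From mathcomp Require Import all_boot all_order all_algebra fingroup perm.
From mathcomp Require Import all_classical all_reals all_analysis.

Set Implicit Arguments.
Unset Strict Implicit.
Unset Printing Implicit Defensive.

Import Order.TTheory GRing.Theory Num.Theory.
Import numFieldNormedType.Exports.

Local Open Scope classical_set_scope.
Local Open Scope ring_scope.

(* In MathComp [(s * t) x = t (s x)]; here [perm_comp u v] is [u] after [v]. *)
Definition perm_comp n (u v : 'S_n) : 'S_n := (v * u)%g.

(* Indices start at 0, so the simple reflections are the (a, a + 1) with
   0 <= a and a + 1 < n. *)
Definition simple_refl n (s : 'S_n) : bool :=
  [exists a : 'I_n, exists b : 'I_n, (b == a.+1 :> nat) && (s == tperm a b)].

Definition word_prod n (s : seq 'S_n) : 'S_n := foldr (@perm_comp n) 1%g s.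

Definition is_word n (s : seq 'S_n) (w : 'S_n) : bool :=
  all (@simple_refl n) s && (word_prod s == w).

Lemma word_prod_cat n (s t : seq 'S_n) :
  word_prod (s ++ t) = perm_comp (word_prod s) (word_prod t).
Proof.
elim: s => [|x s IH] /=; first by rewrite /perm_comp mulg1.
by rewrite IH /perm_comp mulgA.
Qed.

Lemma is_word_comp n (s t : seq 'S_n) u v :
  is_word s u -> is_word t v -> is_word (s ++ t) (perm_comp u v).
Proof.
move=> /andP[hs /eqP<-] /andP[ht /eqP<-].
by rewrite /is_word all_cat hs ht word_prod_cat /=.
Qed.

Lemma tperm_word n k (a b : 'I_n) :
  b = (a + k.+1)%N :> nat -> exists s, is_word s (tperm a b).
Proof.
elim: k b => [|k IH] b hb.
  exists [:: tperm a b]; rewrite /is_word /= /perm_comp mul1g eqxx /= !andbT.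
  apply/existsP; exists a; apply/existsP; exists b.
  by rewrite hb addn1 !eqxx.
have hc : (a + k.+1 < n)%N.
  by apply: ltn_trans (ltn_ord b); rewrite hb ltn_add2l.
pose c := Ordinal hc.
have [s hs] := IH c erefl.
have hcb : is_word [:: tperm c b] (tperm c b).
  rewrite /is_word /= /perm_comp mul1g eqxx /= !andbT.
  apply/existsP; exists c; apply/existsP; exists b.
  by rewrite hb /= !addnS !eqxx.
exists ([:: tperm c b] ++ (s ++ [:: tperm c b])).
suff -> : tperm a b = perm_comp (tperm c b) (perm_comp (tperm a c) (tperm c b)).
  exact: is_word_comp hcb (is_word_comp hs hcb).
have nac : a != c.
  by apply/eqP => /(congr1 val) /= /eqP; rewrite -{1}[val a]addn0 eqn_add2l.
have nab : a != b.
  by apply/eqP => /(congr1 val) /= /eqP; rewrite hb -{1}[val a]addn0 eqn_add2l.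
have -> : perm_comp (tperm c b) (perm_comp (tperm a c) (tperm c b)) =
          (tperm a c ^ tperm c b)%g.
  by rewrite /perm_comp /conjg tpermV mulgA.
by rewrite tpermJ tpermL tpermD // eq_sym.
Qed.

Lemma has_word n (w : 'S_n) : exists s, is_word s w.
Proof.
have [ts -> hts] := prod_tpermP w.
elim: ts hts => [|[a b] ts IH] /=.
  by move=> _; exists [::]; rewrite big_nil /is_word /=.
move=> /andP[nab /IH [s hs]]; rewrite big_cons.
suff [t ht] : exists t, is_word t (tperm a b).
  by exists (s ++ t); exact: (is_word_comp hs ht).
have [ltab|ltba|eab] := ltngtP a b; last by rewrite (ord_inj eab) eqxx in nab.
- by apply: (@tperm_word _ (b - a.+1)); rewrite addnS -addSn subnKC.
- by rewrite tpermC; apply: (@tperm_word _ (a - b.+1));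
    rewrite addnS -addSn subnKC.
Qed.

Lemma has_word_size n (w : 'S_n) :
  exists k, `[< exists2 s, is_word s w & size s = k >].
Proof. by have [s hs] := has_word w; exists (size s); apply/asboolP; exists s. Qed.

Definition length n (w : 'S_n) : nat := ex_minn (has_word_size w).

Definition reduced_word n (s : seq 'S_n) (w : 'S_n) : Prop :=
  is_word s w /\ size s = length w.

Definition bruhat_le n (v w : 'S_n) : Prop :=
  exists2 s, reduced_word s w & exists2 t, subseq t s & word_prod t = v.

Definition covers n (w w' : 'S_n) : Prop :=
  bruhat_le w' w /\ length w = (length w' + 1)%N.

Definition eroot n (a b : 'I_n) : 'rV[int]_n := delta_mx 0 a - delta_mx 0 b.

(* [perm_act w e_a = e_(w a)] *)
Definition perm_act n (w : 'S_n) (v : 'rV[int]_n) : 'rV[int]_n :=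
  \row_k v 0 ((w^-1)%g k).

Definition neg_root n (v : 'rV[int]_n) : bool :=
  [exists a : 'I_n, exists b : 'I_n, (b < a)%N && (v == eroot a b)].

(* The pair (a, b) with a < b encodes the positive root e_a - e_b. *)
Definition Pi_set n (w : 'S_n) : {set 'I_n * 'I_n} :=
  [set p : 'I_n * 'I_n |
    (p.1 < p.2)%N && neg_root (perm_act (w^-1)%g (eroot p.1 p.2))].

Definition phi n (w : 'S_n) : 'rV[int]_n := \sum_(p in Pi_set w) eroot p.1 p.2.

(* The reflection in e_a - e_b is the transposition (a, b). The value is 0 when
   no such integer exists. *)
Definition kappa n (w w' : 'S_n) : int :=
  xget 0 [set k : int | exists a b : 'I_n,
    [/\ (a < b)%N, w = perm_comp (tperm a b) w' &
        phi w - phi w' = eroot a b *~ k]].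

Definition SL (R : realType) n : set 'M[R]_n := [set g | \det g = 1].

(* [flag g k] is the canonical matrix whose row space is the span of the first
   [k] columns of [g]; two elements of Sl(n, R) have the same flag iff they lie
   in the same left coset of the subgroup of upper triangular matrices. *)
Definition flag (R : realType) n (g : 'M[R]_n) : {ffun 'I_n.+1 -> 'M[R]_n} :=
  [ffun k : 'I_n.+1 => <<\matrix_(a, b) (if (a < k)%N then g b a else 0)>>%MS].

Definition same_flag (R : realType) n : rel (@SL R n) :=
  fun g h => flag (val g) == flag (val h).

Lemma same_flag_equiv (R : realType) n : equiv_class_of (@same_flag R n).
Proof.
rewrite /same_flag; split=> [g | g h | h g k] /=; first exact: eqxx.
- by rewrite eq_sym.
- by move=> /eqP -> /eqP ->.
Qed.

Canonical same_flag_equiv_rel (R : realType) n :=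
  EquivRelPack (same_flag_equiv R n).
Canonical same_flag_encModRel (R : realType) n :=
  defaultEncModRel (@same_flag R n).

Definition flag_manifold (R : realType) n : topologicalType :=
  quotient_topology {eq_quot (@same_flag R n)}%qT.

Definition flag_of (R : realType) n (g : @SL R n) : flag_manifold R n :=
  \pi_({eq_quot (@same_flag R n)})%qT g.

Definition unipotent_upper (R : realType) n (u : 'M[R]_n) : Prop :=
  is_trig_mx u^T /\ forall a, u a a = 1.

(* [perm_mx w^-1] sends the column vector e_a to e_(w a). It may have
   determinant -1, hence the detour through an element of Sl(n, R) with the same
   flag. *)
Definition bruhat_cell (R : realType) n (w : 'S_n) : set (flag_manifold R n) :=
  [set x | exists u (g : @SL R n),
    [/\ unipotent_upper u, flag (val g) = flag (u *m perm_mx (w^-1)%g) &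
        x = flag_of g]].

Definition schubert_cell (R : realType) n (w : 'S_n) : set (flag_manifold R n) :=
  closure (@bruhat_cell R n w).

Definition schubert_frontier (R : realType) n (w : 'S_n) :
  set (flag_manifold R n) := @schubert_cell R n w `\` @bruhat_cell R n w.

(* The union of the cells of dimension < [d]. *)
Definition skeleton_lt (R : realType) n (d : nat) : set (flag_manifold R n) :=
  \bigcup_(w in [set w : 'S_n | (length w < d)%N]) @bruhat_cell R n w.

Definition std_simplex (R : realType) d : set 'rV[R]_d.+1 :=
  [set t | (forall k, 0 <= t 0 k) /\ \sum_k t 0 k = 1].

Definition coface_row (R : realType) d (i : 'I_d.+2) (t : 'rV[R]_d.+1) :
  'rV[R]_d.+2 := \row_j (if unlift i j is Some k then t 0 k else 0).

Lemma coface_subproof (R : realType) d (i : 'I_d.+2) (t : @std_simplex R d) :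
  coface_row i (val t) \in @std_simplex R d.+1.
Proof.
have [t_ge0 t_sum] := set_mem (valP t).
apply/mem_set; split=> [k|]; first by rewrite mxE; case: unliftP.
rewrite (bigD1_ord i) //= mxE unlift_none add0r -[RHS]t_sum.
by apply: eq_bigr => k _; rewrite mxE liftK.
Qed.

Definition coface (R : realType) d (i : 'I_d.+2) (t : @std_simplex R d) :
  @std_simplex R d.+1 := exist _ (coface_row i (val t)) (coface_subproof i t).

(* A chain is an integer-valued function on maps from the standard simplex;
   [chain_in A] requires it to be a finite combination of continuous ones with
   values in [A]. *)
Definition sing_chain (R : realType) (X : topologicalType) d : Type :=
  (@std_simplex R d -> X) -> int.

Definition chain_in (R : realType) (X : topologicalType) (A : set X) d
    (z : sing_chain R X d) : Prop :=
  finite_set [set s | z s != 0] /\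
  forall s, z s != 0 -> continuous s /\ forall t, A (s t).

(* The coefficient of a [d]-simplex [t] in the boundary of [z]. *)
Definition boundary (R : realType) (X : topologicalType) d
    (z : sing_chain R X d.+1) : sing_chain R X d :=
  fun t => \sum_(i < d.+2)
    (-1) ^+ i *
      \sum_(s \in [set s : @std_simplex R d.+1 -> X | s \o coface i = t]) z s.

Definition boundary_in (R : realType) (X : topologicalType) (B : set X) d :
    sing_chain R X d -> Prop :=
  if d is d'.+1 then fun z => chain_in B (boundary z) else fun=> True.

Definition rel_cycle (R : realType) (X : topologicalType) (A B : set X) d
    (z : sing_chain R X d) : Prop :=
  chain_in A z /\ boundary_in B z.

(* [y] and [z] differ by a relative boundary of the pair (A, B). *)
Definition rel_homologous (R : realType) (X : topologicalType) (A B : set X) d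
    (y z : sing_chain R X d) : Prop :=
  exists (b : sing_chain R X d.+1) (r : sing_chain R X d),
    [/\ chain_in A b, chain_in B r & y - z = boundary b + r].

(* [z] represents a generator of the infinite cyclic group
   H_d(S_w, S_w \ cell), d = length w, i.e. an orientation of the cell. *)
Definition cell_orientation (R : realType) n (w : 'S_n)
    (z : sing_chain R (flag_manifold R n) (length w)) : Prop :=
  let A := @schubert_cell R n w in
  let B := @schubert_frontier R n w in
  rel_cycle A B z /\
  forall y : sing_chain R (flag_manifold R n) (length w), rel_cycle A B y ->
    exists m : int, rel_homologous A B y (z *~ m).

(* The cellular boundary is the connecting map H_d+1(X^d+1, X^d) ->
   H_d(X^d, X^d-1), X^d being the [d]-skeleton, and c w w' is the coefficient of
   the class of the cell of w' in the image of the class of the cell of w. These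
   coefficients depend on the orientations only through signs. [z d w] is used
   only for d = length w, and c w w' only for length w = length w' + 1. *)
Definition cellular_boundary_coef (R : realType) n
    (z : forall d, 'S_n -> sing_chain R (flag_manifold R n) d)
    (c : 'S_n -> 'S_n -> int) : Prop :=
  (forall w, cell_orientation (z (length w) w)) /\
  forall d w, length w = d.+1 ->
    rel_homologous (@skeleton_lt R n d.+1) (@skeleton_lt R n d)
      (boundary (z d.+1 w))
      (\sum_(w' : 'S_n | length w' == d) z d w' *~ c w w').

(* Main.v *)
(* The coefficient of e_k in phi w is
   #{b > k | w^-1 b < w^-1 k} - #{a < k | w^-1 k < w^-1 a}, which equals
   w^-1 k - k (positions counted from 0). Passing from w' to w = w' (i j) only
   exchanges the values of the inverse at w' i and w' j, so
   phi w - phi w' = (j - i) (e_(w' i) - e_(w' j)). The covering relation enters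
   through w' i < w' j, which makes that root positive: otherwise the exchange
   condition gives length w < length w'. *)

Require Import Defs.
From HB Require Import structures.
From mathcomp Require Import all_boot all_order all_algebra fingroup perm.
From mathcomp Require Import all_classical all_reals all_analysis.
From mathcomp Require Import zify.

Set Implicit Arguments.
Unset Strict Implicit.
Unset Printing Implicit Defensive.

Import Order.TTheory GRing.Theory Num.Theory.

Local Open Scope ring_scope.

Lemma perm_compE n (u v : 'S_n) x : perm_comp u v x = u (v x).
Proof. by rewrite permM. Qed.

Lemma length_leq_size n (s : seq 'S_n) w : is_word s w -> (length w <= size s)%N.
Proof.
rewrite /length => hs; case: ex_minnP => m _; apply.
by apply/asboolP; exists s.
Qed.

Lemma reduced_word_exists n (w : 'S_n) : exists s, reduced_word s w.
Proof.
rewrite /reduced_word /length.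
by case: ex_minnP => m /asboolP[s hs <-] _; exists s.
Qed.

Lemma simple_refl_reverses n (s : 'S_n) (i j : 'I_n) :
  simple_refl s -> (i < j)%N -> (s j < s i)%N -> s = tperm i j.
Proof.
move=> /existsP[a /existsP[b /andP[/eqP hb /eqP ->]]].
by case: tpermP => [->|->|_ _]; case: tpermP => [->|->|_ _] //; lia.
Qed.

(** Strong exchange condition, by peeling off the leftmost letter [x], so that [u = x v]. If [v]
    already reverses [i] and [j], induction shortens the word of [v]; otherwise [x] does the
    reversing and is the letter to delete. *)
Lemma exchange n (s : seq 'S_n) (u : 'S_n) (i j : 'I_n) :
  is_word s u -> (i < j)%N -> (u j < u i)%N ->
  exists2 t, is_word t (perm_comp u (tperm i j)) & (size t < size s)%N.
Proof.
move=> hs ltij; elim: s u hs => [|x s IH] u /andP[] /=.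
  by move=> _ /eqP <-; rewrite !perm1 ltnNge ltnW.
move=> /andP[hx hs] /eqP <-; set v := word_prod s.
have hv : is_word s v by rewrite /is_word hs eqxx.
rewrite !perm_compE => ltu.
have [ltv|ltv|/val_inj/perm_inj eij] := ltngtP (v i) (v j).
- have -> : x = tperm (v i) (v j) by apply: simple_refl_reverses.
  exists s; last exact: ltnSn.
  (* Since [v (i j) v^-1 = (v i, v j)], the two reflections cancel. *)
  suff -> : perm_comp (perm_comp (tperm (v i) (v j)) v) (tperm i j) = v by [].
  by rewrite /perm_comp -tpermJ /conjg !mulgA mulgK tperm2 mul1g.
- have [t /andP[ht /eqP et] lt_t] := IH v hv ltv.
  exists (x :: t) => //; rewrite /is_word /= hx ht et /=.
  by rewrite /perm_comp !mulgA.
- by rewrite eij ltnn in ltij.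
Qed.

Lemma length_reflection_lt n (u : 'S_n) (i j : 'I_n) :
  (i < j)%N -> (u j < u i)%N -> (length (perm_comp u (tperm i j)) < length u)%N.
Proof.
move=> ltij ltu; have [s [hs <-]] := reduced_word_exists u.
have [t ht] := exchange hs ltij ltu.
exact/leq_ltn_trans/length_leq_size.
Qed.

Lemma erootE n (a b k : 'I_n) : eroot a b 0 k = (k == a)%:Z - (k == b)%:Z.
Proof. by rewrite !mxE !eqxx !natz. Qed.

Lemma perm_act_eroot n (w : 'S_n) a b :
  perm_act w (eroot a b) = eroot (w a) (w b).
Proof.
apply/rowP => k; rewrite mxE !erootE.
by rewrite -![_ == w _](inj_eq (@perm_inj _ w^-1%g)) !permK.
Qed.

Lemma neg_root_eroot n (a b : 'I_n) : neg_root (eroot a b) = (b < a)%N.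
Proof.
apply/existsP/idP => [[c /existsP[d /andP[ltdc /eqP eqr]]]|ltba]; last first.
  by exists a; apply/existsP; exists b; rewrite ltba eqxx.
have necd : (c == d) = false by apply/eqP => e; rewrite e ltnn in ltdc.
(* The entry -1 at [d] forces [d = b], and the entry 1 at [c] forces [c = a]. *)
have /rowP eqrk := eqr; have := eqrk c; have := eqrk d.
rewrite !erootE !eqxx necd [d == c]eq_sym necd.
case: (d =P b) => [<- _|_]; last by case: (d == a).
by case: (c =P a) => [<-|_]; last by case: (c == d).
Qed.

Lemma mem_Pi_set n (w : 'S_n) p :
  (p \in Pi_set w) = (p.1 < p.2)%N && ((w^-1)%g p.2 < (w^-1)%g p.1)%N.
Proof. by rewrite inE perm_act_eroot neg_root_eroot. Qed.

Lemma sum_ord_lt n (k : 'I_n) : \sum_(x < n) (x < k)%N%:Z = k%:Z.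
Proof.
under eq_bigr do rewrite (fun_if Posz).
rewrite -big_mkcond /= -(@big_ord_widen _ _ _ _ _ (fun=> 1)); last exact: ltnW.
by rewrite sumr_const card_ord natz.
Qed.

(* Adding #{x < k | w^-1 x < w^-1 k} to both counts in the difference
   turns them into [w^-1 k] and [k]. *)
Lemma phiE n (w : 'S_n) k : phi w 0 k = ((w^-1)%g k)%:Z - k%:Z.
Proof.
set v := (w^-1)%g.
have -> : phi w 0 k = \sum_(a < n) \sum_(b < n)
    ((a < b) && (v b < v a))%N%:Z * ((k == a)%:Z - (k == b)%:Z).
  rewrite /phi summxE big_mkcond pair_bigA /=; apply: eq_bigr => p _.
  by rewrite mem_Pi_set erootE -/v; case: ifP; rewrite ?mul1r ?mul0r.
under eq_bigr do (under eq_bigr do rewrite mulrBr); under eq_bigr do rewrite sumrB.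
rewrite sumrB [X in _ - X]exchange_big /=.
rewrite (bigD1 k) //= [X in _ + X - _]big1 ?addr0; last first.
  move=> a; rewrite eq_sym => /negPf ->; by rewrite big1 // => b _; rewrite mulr0.
rewrite [X in _ - X](bigD1 k) //= [X in _ - (_ + X)]big1 ?addr0; last first.
  move=> a; rewrite eq_sym => /negPf ->; by rewrite big1 // => b _; rewrite mulr0.
rewrite eqxx -(sum_ord_lt k) -(sum_ord_lt (v k)).
(* After [x] is replaced by [v x] in the sum for [v k], the identity holds term by term:
   [[k < x][v x < v k] - [x < k][v k < v x] = [v x < v k] - [x < k]]. *)
rewrite [in RHS](reindex_inj (@perm_inj _ v)) /=.
rewrite -!sumrB; apply: eq_bigr => x _; rewrite !mulr1.
have [->|nexk] := eqVneq x k; first by rewrite !ltnn.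
have nev : v x != v k by rewrite (inj_eq perm_inj).
have {}nexk : (x : nat) != k by []; have {}nev : (v x : nat) != v k by [].
by case: (ltngtP x k) nexk; case: (ltngtP (v x) (v k)) nev => // ->; rewrite eqxx.
Qed.

Lemma phi_reflection n (w : 'S_n) (i j : 'I_n) :
  phi (perm_comp w (tperm i j)) - phi w =
  eroot (w i) (w j) *~ (j%:Z - i%:Z).
Proof.
apply/rowP => k; rewrite -scaler_int !mxE -/(phi _) !phiE -(permKV w k).
(* At [k = w l] the claim reads [(i j) l - l = (j - i) ([l = i] - [l = j])]. *)
rewrite !(inj_eq perm_inj); set l := (w^-1)%g k.
rewrite /perm_comp invMg tpermV permM permK intz !eqxx !natz /=.
rewrite opprB addrA subrK.
case: tpermP => [->|->|/eqP/negPf -> /eqP/negPf ->]; rewrite ?eqxx ?subrr ?mulr0 //.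
  (* The case [i = j] is allowed here; both sides then vanish. *)
  by case: eqP => [->|_]; rewrite ?subrr ?mul0r ?subr0 ?mulr1.
by case: eqP => [->|_]; rewrite ?subrr ?mul0r ?sub0r ?mulrN1 ?opprB.
Qed.

(** Makes the positive root in [kappa] unique. As [(c d)] moves [a] to [b], the only alternative is
    [a = d], [b = c], against the orderings. *)
Lemma tperm_ltn_inj n (a b c d : 'I_n) :
  (a < b)%N -> (c < d)%N -> tperm a b = tperm c d -> (a, b) = (c, d).
Proof.
move=> ltab ltcd e.
have nab : b != a by rewrite neq_ltn ltab orbT.
have := tpermL a b; rewrite e; case: tpermP => [-> ->|ac db|_ _ eab] //.
  by move: ltcd; rewrite -ac db => /ltnW; rewrite leqNgt ltab.
by rewrite eab eqxx in nab.
Qed.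

Theorem proposition3p13 (n : nat) (w w' : 'S_n) (i j : 'I_n)
    (hcov : covers w w') (hij : (i < j)%N) (hw : w = perm_comp w' (tperm i j)) :
  kappa w w' = j%:Z - i%:Z /\
  forall (R : realType)
         (z : forall d : nat, 'S_n -> sing_chain R (flag_manifold R n) d)
         (c : 'S_n -> 'S_n -> int),
    cellular_boundary_coef z c ->
    (forall v v' : 'S_n, covers v v' ->
       c v v' = 1 + (-1) ^ kappa v v' \/ c v v' = - (1 + (-1) ^ kappa v v')) ->
    (c w w' = 0 <-> odd (j - i)).
Proof.
have ltw : (w' i < w' j)%N.
  have [//|ltw|/val_inj/perm_inj eij] := ltngtP (w' i) (w' j).
    have := length_reflection_lt hij ltw; case: hcov => _.
    by rewrite -hw addn1 => ->; rewrite ltnNge leqnSn.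
  by rewrite eij ltnn in hij.
(* Conjugation by [w'] turns the right factor [(i j)] into the left reflection that [kappa] asks
   for. *)
have tw : perm_comp (tperm (w' i) (w' j)) w' = w.
  by rewrite hw /perm_comp -tpermJ /conjg !mulgA mulgV mul1g.
have kapE : kappa w w' = j%:Z - i%:Z.
  apply: xget_unique => [|k [a [b [ltab wab]]]].
    by exists (w' i), (w' j); split; rewrite // hw phi_reflection.
  have [-> ->] : (a, b) = (w' i, w' j).
    apply: tperm_ltn_inj => //; apply: (mulgI w').
    by have := tw; rewrite wab.
  (* The root has entry 1 at [w' i], so this coordinate reads off [k]. *)
  move=> /(congr1 (fun v : 'rV_n => v 0 (w' i))).
  rewrite hw phi_reflection -!scaler_int !mxE !eqxx /= (inj_eq perm_inj).
  have -> : (i == j) = false by apply/eqP => e; rewrite e ltnn in hij.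
  by rewrite subr0 !mulr1 !intz.
(* As [i < j], the exponent is the natural number [j - i]; by its parity, [c w w'] is 0 or one of 2,
   -2. *)
split=> // R z c _ /(_ _ _ hcov); rewrite kapE subzn 1?ltnW // -exprnP -signr_odd.
by case: (odd _) => -[] ->.
Qed.
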